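(* Let $(A,[\cdot,\dots,\cdot],\alpha)$ be an $n$-ary Hom-algebra with $\dim A=n+1$, $[\cdot,\dots,\cdot]$ skew-symmetric and $\alpha$ nilpotent. Let $(e_i)_{1\le i\le n+1}$ be a basis of $A$ in which $\alpha$ is in its Jordan form, and let $w_1,\dots,w_{n+1}\in A$ be defined by $$[e_1,\dots,\widehat{e_i},\dots,e_{n+1}]=(-1)^{n+1+i}w_i,\qquad 1\le i\le n+1.$$ If $\dim\ker\alpha\ge 2$, then $(A,[\cdot,\dots,\cdot],\alpha)$ is multiplicative if and only if $[A,\dots,A]\subseteq\ker\alpha$. If $\dim\ker\alpha=1$, then $(A,[\cdot,\dots,\cdot],\alpha)$ is multiplicative if and only if $\alpha(w_1)=(-1)^n w_{n+1}$ and $w_i\in\ker\alpha$ for all $2\le i\le n+1$.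
   Context: All linear spaces are over a field $\mathbb{K}$ of characteristic $0$, and $n\ge2$. Here an $n$-ary Hom-algebra $(A,[\cdot,\dots,\cdot],\alpha)$ is a linear space $A$ with an $n$-linear map $[\cdot,\dots,\cdot]:A^n\to A$ and a linear map $\alpha:A\to A$. It is called multiplicative if $\alpha([x_1,\dots,x_n])=[\alpha(x_1),\dots,\alpha(x_n)]$ for all $x_1,\dots,x_n\in A$. The hat $\widehat{e_i}$ means that $e_i$ is omitted. $[A,\dots,A]$ is the linear span of all brackets. Jordan form is with the $1$'s on the superdiagonal, i.e. each $e_i$ is sent by $\alpha$ to $0$ or to $e_{i-1}$; when $\dim\ker\alpha=1$ this means $\alpha(e_1)=0$ and $\alpha(e_i)=e_{i-1}$ for $2\le i\le n+1$. *)

(* Defs.v *)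
From HB Require Import structures.
From mathcomp Require Import all_boot all_order all_fingroup all_algebra.

Set Implicit Arguments.
Unset Strict Implicit.
Unset Printing Implicit Defensive.

Import GRing.Theory.
Local Open Scope ring_scope.

Definition multilinear_map (K : fieldType) (n : nat) (A : vectType K)
    (f : {ffun 'I_n -> A} -> A) : Prop :=
  forall (x : {ffun 'I_n -> A}) (i : 'I_n) (a : K) (u v : A),
    let subst y := [ffun j => if j == i then y else x j] in
    f (subst (a *: u + v)) = a *: f (subst u) + f (subst v).

Record hom_algebra (K : fieldType) (n : nat) (A : vectType K) := HomAlgebra {
  bracket : {ffun 'I_n -> A} -> A;
  twist : 'End(A);
  bracket_multilinear : multilinear_map bracket }.

Section HomAlgebra.

Variables (K : fieldType) (n : nat) (A : vectType K).
Implicit Type H : hom_algebra n A.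

Definition skew_symmetric H : Prop :=
  forall (s : 'S_n) (x : {ffun 'I_n -> A}),
    bracket H [ffun i => x (s i)] = (-1) ^+ s *: bracket H x.

Definition hom_multiplicative H : Prop :=
  forall x : {ffun 'I_n -> A},
    twist H (bracket H x) = bracket H [ffun i => twist H (x i)].

(* Membership in [A, ..., A]: the library's span takes a finite sequence, and
   an element of the span of all brackets lies in the span of finitely many. *)
Definition in_bracket_span H (v : A) : Prop :=
  exists s : seq {ffun 'I_n -> A}, v \in <<[seq bracket H x | x <- s]>>%VS.

Definition nilpotent_map (f : 'End(A)) : Prop :=
  exists m : nat, forall v : A, iter m f v = 0.

(* Only for nilpotent f, so that the diagonal of the Jordan form vanishes. The
   first basis vector, having no predecessor, is necessarily sent to 0. *)
Definition nilpotent_jordan_basis (f : 'End(A)) (m : nat) (e : m.-tuple A) :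
    Prop :=
  basis_of fullv e /\
  forall i : 'I_m,
    f (tnth e i) = 0 \/
    exists j : 'I_m, i = j.+1 :> nat /\ f (tnth e i) = tnth e j.

(* The bracket of e with its i-th entry omitted. *)
Definition bracket_omit H (e : n.+1.-tuple A) (i : 'I_n.+1) : A :=
  bracket H [ffun j : 'I_n => tnth e (lift i j)].

End HomAlgebra.

(* Main.v *)
Require Import Defs.
From HB Require Import structures.
From mathcomp Require Import all_boot all_order all_fingroup all_algebra.

Set Implicit Arguments.
Unset Strict Implicit.
Unset Printing Implicit Defensive.

Import GRing.Theory.
Local Open Scope ring_scope.

(* Multiplicativity says that the defect x |-> alpha [x] - [alpha x] vanishes.
   The defect is again multilinear and skew-symmetric, so it vanishes as soon as
   it does on the n+1 tuples obtained from the basis by omitting one vector. On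
   such a tuple [alpha x] = 0 whenever some remaining basis vector is killed by
   alpha. If dim ker alpha >= 2 this happens for every omitted vector; if
   dim ker alpha = 1 then alpha is the shift of the basis and the only exception
   is the tuple (e_2, ..., e_{n+1}), sent by alpha to (e_1, ..., e_n). *)

(** * Vanishing criteria for multilinear and skew-symmetric maps *)

Section MultilinearMaps.

Variables (K : fieldType) (n : nat) (A : vectType K).
Implicit Types (f : {ffun 'I_n -> A} -> A) (x : {ffun 'I_n -> A}).

Lemma multilinear_sum f (f_ml : multilinear_map f) x (i : 'I_n) (m : nat)
    (c : 'I_m -> K) (v : 'I_m -> A) :
  f [ffun j => if j == i then \sum_k c k *: v k else x j] =
  \sum_k c k *: f [ffun j => if j == i then v k else x j].
Proof.
pose g y := f [ffun j => if j == i then y else x j].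
have gP a u y : g (a *: u + y) = a *: g u + g y by exact: f_ml.
have g0 : g 0 = 0.
  by have := gP 1 0 0; rewrite !scale1r addr0 -[X in X = _]addr0 => /addrI <-.
rewrite -/(g _); apply: (big_ind2 (fun y z => g y = z)) => [|y ? z ? <- <-|k _].
- exact: g0.
- by rewrite -[y in LHS]scale1r gP scale1r.
- by rewrite -[_ *: v k]addr0 gP g0 addr0.
Qed.

Lemma multilinear_eq0 f (f_ml : multilinear_map f) x (i : 'I_n) :
  x i = 0 -> f x = 0.
Proof.
(* The zero entry is written as an empty sum, the case [m = 0] of [multilinear_sum]. *)
move=> xi0; have := multilinear_sum f_ml x i (fun=> 0) (fun _ : 'I_0 => 0).
rewrite !big_ord0 => <-; congr f; apply/ffunP => j; rewrite ffunE.
by case: eqP => [->|].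
Qed.

Lemma multilinear_basis_eq0 f (f_ml : multilinear_map f) (m : nat)
    (e : m.-tuple A) (e_full : <<e>>%VS = fullv) :
    (forall s : 'I_n -> 'I_m, f [ffun j => tnth e (s j)] = 0) ->
  forall x, f x = 0.
Proof.
move=> f0 x.
(* Induction on the number [k] of leading entries that may be arbitrary, all later ones being
   vectors of [e]. The step expands the entry at position [k] along [e]. *)
suff IH k (y : {ffun 'I_n -> A}) : (forall i : 'I_n, (k <= i)%N -> exists l, y i = tnth e l) ->
    f y = 0.
  by apply: (IH n) => i; rewrite leqNgt ltn_ord.
elim: k y => [|k IHk] y y_e.
  have /fin_all_exists[s y_s] : forall i, exists l, y i = tnth e l.
    by move=> i; apply: y_e.
  by rewrite -(f0 s); congr f; apply/ffunP => j; rewrite ffunE.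
have [k_lt|n_le] := ltnP k n; last first.
  by apply: IHk => i k_le; have := leq_trans n_le k_le; rewrite leqNgt ltn_ord.
pose i0 := Ordinal k_lt.
have -> : y = [ffun j => if j == i0 then
    \sum_l coord e l (y i0) *: tnth e l else y j].
  apply/ffunP => j; rewrite ffunE; case: eqP => [->|//].
  rewrite {1}(@coord_span _ _ _ e (y i0)) ?e_full ?memvf //.
  by apply: eq_bigr => l _; rewrite (tnth_nth 0).
rewrite multilinear_sum // big1 // => l _.
rewrite IHk ?scaler0 // => i k_le; rewrite ffunE.
case: eqP => [_|/eqP i_neq]; first by exists l.
by apply: y_e; rewrite ltn_neqAle k_le andbT eq_sym.
Qed.

(** Stated for a bare map so that it also applies to the defect and to alpha composed with the
    bracket. *)
Definition skew_map f : Prop :=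
  forall (s : 'S_n) x, f [ffun i => x (s i)] = (-1) ^+ s *: f x.

(** The transposition of [i] and [j] fixes [x] and is odd, hence [f x = - f x]. *)
Lemma skew_repeat_eq0 (charK2 : (2%:R : K) != 0) f (f_skew : skew_map f) x
    (i j : 'I_n) : i != j -> x i = x j -> f x = 0.
Proof.
move=> ij xij; have := f_skew (tperm i j) x.
have -> : [ffun k => x (tperm i j k)] = x.
  by apply/ffunP => k; rewrite ffunE; case: tpermP => // ->.
rewrite odd_tperm ij expr1 scaleN1r => /eqP.
by rewrite -addr_eq0 -mulr2n -scaler_nat scaler_eq0 (negPf charK2) => /eqP.
Qed.

(** By counting, [s] misses some [i], so it factors through [lift i]; the other factor is an
    injective self-map of a finite set, hence a permutation. *)
Lemma inj_ord_lift (s : 'I_n -> 'I_n.+1) : injective s ->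
  exists (i : 'I_n.+1) (p : 'S_n), forall j, s j = lift i (p j).
Proof.
move=> s_inj.
have [i i_s] : exists i, i \notin codom s.
  apply/existsP; rewrite -negb_forall; apply/negP => /forallP s_surj.
  have codom_full : #|codom s| = #|'I_n.+1|.
    by apply: eq_card => i; rewrite s_surj.
  by have := card_codom s_inj; rewrite codom_full !card_ord; apply/eqP; rewrite gtn_eqF.
have i_neq j : i != s j.
  by apply: contra i_s => /eqP ->; apply: codom_f.
have /fin_all_exists[p p_s] : forall j, exists l, s j = lift i l.
  by move=> j; case: (unlift_some (i_neq j)) => l; exists l.
have p_inj : injective p by move=> j k pjk; apply: s_inj; rewrite !p_s pjk.
by exists i, (perm p_inj) => j; rewrite permE.
Qed.

(** A tuple of vectors of [e] either repeats an index, or is a permutation of a tuple omitting one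
    index. *)
Lemma multilinear_skew_eq0 (charK2 : (2%:R : K) != 0) f
    (f_ml : multilinear_map f) (f_skew : skew_map f) (e : n.+1.-tuple A)
    (e_full : <<e>>%VS = fullv) :
    (forall i, f [ffun j => tnth e (lift i j)] = 0) ->
  forall x, f x = 0.
Proof.
move=> f0; apply: (multilinear_basis_eq0 f_ml e_full) => s.
have [/injectiveP s_inj|/injectivePn[i [j ij sij]]] := boolP (injectiveb s).
  have [i [p s_p]] := inj_ord_lift s_inj.
  have := f_skew p [ffun j => tnth e (lift i j)].
  rewrite f0 scaler0 => <-; congr f.
  by apply/ffunP => j; rewrite !ffunE s_p.
by apply: (skew_repeat_eq0 charK2 f_skew ij); rewrite !ffunE sij.
Qed.

End MultilinearMaps.

(** * Nilpotent Jordan bases and the dimension of the kernel *)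

Section JordanBasis.

Variables (K : fieldType) (n : nat) (A : vectType K).
Variables (f : 'End(A)) (e : n.+1.-tuple A).
Hypothesis jordan_e : nilpotent_jordan_basis f e.

Lemma jordan_basis_ord0 : f (tnth e ord0) = 0.
Proof. by case: jordan_e => _ /(_ ord0)[//|[j []]]. Qed.

(** As numbers, [lift ord0 j] is [j.+1] and [lift ord_max j] is [j]. *)
Lemma jordan_basis_lift0 (j : 'I_n) : f (tnth e (lift ord0 j)) != 0 ->
  f (tnth e (lift ord0 j)) = tnth e (lift ord_max j).
Proof.
case: jordan_e => _ /(_ (lift ord0 j))[-> /eqP //|[k [jk ->]] _].
by congr tnth; apply: val_inj; rewrite [RHS]lift_max; case: jk.
Qed.

Lemma jordan_basis_ker1 (j : 'I_n) : \dim (lker f) = 1%N ->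
  f (tnth e (lift ord0 j)) = tnth e (lift ord_max j).
Proof.
move=> ker1; apply: jordan_basis_lift0; apply/eqP => fj0.
have e_free : free e by case: jordan_e => /basis_free.
have e0_neq0 : tnth e ord0 != 0 by apply: (free_not0 e_free); apply: mem_tnth.
have /eqP ker_e0 : <[tnth e ord0]>%VS == lker f.
  by rewrite eqEdim -memvE memv_ker jordan_basis_ord0 eqxx ker1 dim_vline e0_neq0.
have : tnth e (lift ord0 j) \in <[tnth e ord0]>%VS by rewrite ker_e0 memv_ker fj0.
(* A killed vector other than the first would be a multiple of it; its own coordinate then reads 1 =
   0. *)
case/vlineP => c /(congr1 (coord e (lift ord0 j))).
rewrite linearZ /= !(tnth_nth 0) !coord_free // eqxx mulr0 => /eqP.
by rewrite oner_eq0.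
Qed.

(** Otherwise the omitted vector is the first one, since that one is killed. All others are then
    shifted, so the image contains the first [n] basis vectors and rank-nullity leaves a kernel of
    dimension at most 1. *)
Lemma jordan_basis_ker2 (i : 'I_n.+1) : (2 <= \dim (lker f))%N ->
  exists j : 'I_n, f (tnth e (lift i j)) = 0.
Proof.
move=> ker2; apply/'exists_eqP; apply: contraLR ker2.
rewrite negb_exists -leqNgt => /forallP f_neq0.
have i0 : i = ord0.
  apply/eqP/contraT => /unlift_some[j ej _].
  by have := f_neq0 j; rewrite -ej jordan_basis_ord0 eqxx.
move: f_neq0; rewrite {i}i0 => f_neq0.
have e_basis : basis_of fullv e by case: jordan_e.
have e_take : free (take n e).
  by apply: (@catl_free _ _ (drop n e)); rewrite cat_take_drop (basis_free e_basis).
have sub : (<<take n e>> <= limg f)%VS.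
  apply/span_subvP => v /(nthP 0)[k]; rewrite size_takel ?size_tuple // => kn <-.
  rewrite nth_take //.
  have := jordan_basis_lift0 (f_neq0 (Ordinal kn)).
  rewrite [in RHS](tnth_nth 0) lift_max /= => <-; exact: memv_img (memvf _).
have := dimvS sub; rewrite (eqP e_take) size_takel ?size_tuple //.
have := limg_ker_dim f fullv; rewrite capfv.
rewrite (size_basis e_basis) => dim_eq n_le.
by rewrite -(leq_add2r (\dim (limg f))) dim_eq add1n ltnS.
Qed.

End JordanBasis.

(** * The defect of multiplicativity *)

Section MultiplicativityDefect.

Variables (K : fieldType) (n : nat) (A : vectType K) (H : hom_algebra n A).

Definition mult_defect (x : {ffun 'I_n -> A}) : A :=
  twist H (bracket H x) - bracket H [ffun i => twist H (x i)].

Lemma mult_defect_multilinear : multilinear_map mult_defect.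
Proof.
move=> x i a u v subst; rewrite /mult_defect.
have twist_subst y : [ffun j => twist H (subst y j)] =
    [ffun j => if j == i then twist H y else [ffun k => twist H (x k)] j].
  by apply/ffunP => j; rewrite !ffunE; case: eqP.
rewrite !twist_subst linearP /subst !(bracket_multilinear H) !linearP /=.
by rewrite scalerDr addrACA.
Qed.

Lemma mult_defect_skew : skew_symmetric H -> skew_map mult_defect.
Proof.
move=> skewH s x; rewrite /mult_defect skewH linearZ scalerBr -skewH /=.
by congr (_ - bracket H _); apply/ffunP => i; rewrite !ffunE.
Qed.

Lemma hom_multiplicative_omit (charK2 : (2%:R : K) != 0)
    (skewH : skew_symmetric H) (e : n.+1.-tuple A)
    (e_full : <<e>>%VS = fullv) :
  hom_multiplicative H <->
  forall i, twist H (bracket_omit H e i) =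
            bracket H [ffun j => twist H (tnth e (lift i j))].
Proof.
have twist_omit i : [ffun j => twist H ([ffun k => tnth e (lift i k)] j)] =
    [ffun j => twist H (tnth e (lift i j))].
  by apply/ffunP => j; rewrite !ffunE.
split=> [multH i|omitH x]; first by rewrite multH twist_omit.
apply/eqP; rewrite -subr_eq0; apply/eqP.
apply: (multilinear_skew_eq0 charK2 mult_defect_multilinear
  (mult_defect_skew skewH) e_full) => i.
by rewrite /mult_defect twist_omit -omitH subrr.
Qed.

End MultiplicativityDefect.

(* Indices are 0-based: the ordinal i stands for i.+1 in the
   1-based numbering, which is why i.+1 occurs in the sign. *)
Theorem lemma5 (K : fieldType) (charK0 : [pchar K] =i pred0)
  (n : nat) (n_ge2 : (2 <= n)%N)
  (A : vectType K) (dimA : \dim {:A} = n.+1)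
  (H : hom_algebra n A) (skewH : skew_symmetric H)
  (nilH : nilpotent_map (twist H))
  (e : n.+1.-tuple A) (jordan_e : nilpotent_jordan_basis (twist H) e)
  (w : 'I_n.+1 -> A)
  (def_w : forall i : 'I_n.+1,
     bracket_omit H e i = (-1) ^+ (n.+1 + i.+1) *: w i) :
  ((2 <= \dim (lker (twist H)))%N ->
     (hom_multiplicative H <->
      forall v : A, in_bracket_span H v -> v \in lker (twist H)))
  /\
  (\dim (lker (twist H)) = 1%N ->
     (hom_multiplicative H <->
      (twist H (w ord0) = (-1) ^+ n *: w ord_max
       /\ forall i : 'I_n.+1, (1 <= i)%N -> w i \in lker (twist H)))).
Proof.
have charK2 : (2%:R : K) != 0 by have := charK0 2; rewrite !inE /= => /negbT.
have e_full : <<e>>%VS = fullv by case: jordan_e => /span_basis.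
have multE := hom_multiplicative_omit charK2 skewH e_full.
have bracket0 (i : 'I_n.+1) (j : 'I_n) : twist H (tnth e (lift i j)) = 0 ->
    bracket H [ffun j => twist H (tnth e (lift i j))] = 0.
  by move=> j0; apply: (multilinear_eq0 (bracket_multilinear H) (i := j)); rewrite ffunE.
have signK m (u : A) : ((-1) ^+ m *: u == 0) = (u == 0).
  by rewrite scaler_eq0 signr_eq0.
split=> [ker2|ker1].
  have br0 i : bracket H [ffun j => twist H (tnth e (lift i j))] = 0.
    by have [j /bracket0] := jordan_basis_ker2 jordan_e i ker2.
  split=> [multH v [s]|spanH].
    move: v; apply/subvP; apply/span_subvP => _ /mapP[x _ ->].
    rewrite memv_ker; apply/eqP; move: x.
    (* Alpha composed with the bracket is itself multilinear and skew, so the tuples omitting one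
       basis vector suffice. *)
    apply: (@multilinear_skew_eq0 _ _ _ charK2 (fun x => twist H (bracket H x)) _ _ e e_full).
    - by move=> x i a u v subst; rewrite /subst bracket_multilinear linearP.
    - by move=> p x; rewrite skewH linearZ.
    by move=> i; rewrite -(br0 i) -(multE.1 multH).
  apply/multE => i; rewrite br0; apply/eqP; rewrite -memv_ker; apply: spanH.
  exists [:: [ffun j => tnth e (lift i j)]].
  by apply: memv_span; rewrite mem_head.
have twist_shift : [ffun j => twist H (tnth e (lift ord0 j))] =
    [ffun j => tnth e (lift ord_max j)].
  by apply/ffunP => j; rewrite !ffunE (jordan_basis_ker1 jordan_e).
have omit0 : twist H (bracket_omit H e ord0) =
      bracket H [ffun j => twist H (tnth e (lift ord0 j))] <->
    twist H (w ord0) = (-1) ^+ n *: w ord_max.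
  rewrite twist_shift -/(bracket_omit H e ord_max) !def_w linearZ /=.
  (* The sign at [ord_max] is [(-1) ^+ (2n + 2)], that is 1; the sign at [ord0] is
     [(-1) ^+ (n + 2)], that is [(-1) ^+ n]. *)
  have -> : (-1) ^+ (n.+1 + n.+1) = 1 :> K by rewrite exprD -expr2 sqrr_sign.
  rewrite scale1r addn1 !exprS !mulN1r opprK.
  by split=> [<-|->]; rewrite scalerA -expr2 sqrr_sign scale1r.
have omitS (i : 'I_n.+1) : (1 <= i)%N -> twist H (bracket_omit H e i) =
      bracket H [ffun j => twist H (tnth e (lift i j))] <->
    w i \in lker (twist H).
  (* Since [i] is not [ord0], the first basis vector remains in the tuple and alpha kills it. *)
  move=> i_gt0; have /unlift_some[j j0 _] : i != ord0 by rewrite -lt0n.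
  rewrite (bracket0 i j) -?j0 ?(jordan_basis_ord0 jordan_e) //.
  by rewrite def_w linearZ memv_ker -(signK (n.+1 + i.+1)%N); split=> /eqP.
split=> [/multE multH|[w0 wS]].
  by split=> [|i i_gt0]; [apply/omit0 | apply/omitS].
apply/multE => i; have [i_gt0|i_le0] := ltnP 0 i; first by apply/omitS/wS.
have -> : i = ord0 by apply/val_inj/eqP; rewrite -leqn0.
exact/omit0.
Qed.
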